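(* Let $a,b,q$ be indeterminates and define the $q$-Narayana polynomials $C_n(a,b,q)$ by $C_0(a,b,q)=1$ and, for $n\ge 1$, $$C_n(a,b,q)=a\,C_{n-1}(a,b,q)+b\sum_{k=0}^{n-1}q^k C_k(a,b,q)\,C_{n-k-1}(a,b,q).$$ Then for every $n\ge 0$, $$\det\big(C_{i+j}(a,b,q)\big)_{i,j=0}^{n}=q^{\frac{n^2(n+1)}{2}}\,b^{\binom{n+1}{2}}\prod_{k=0}^{n-1}(a+q^k b)^{\,n-k}$$ and $$\det\big(C_{i+j+1}(a,b,q)\big)_{i,j=0}^{n}=q^{\frac{n(n+1)^2}{2}}\,b^{\binom{n+1}{2}}\prod_{k=0}^{n}(a+q^k b)^{\,n+1-k}.$$
   Context: Equivalently, $f(z,a,b,q)=\sum_{n\ge0}C_n(a,b,q)z^n$ is the unique formal power series with $f(z,a,b,q)=1+azf(z,a,b,q)+bzf(z,a,b,q)f(qz,a,b,q)$. The first values are $1,\ a+b,\ a^2+(2+q)ab+(1+q)b^2,\dots$; for $(a,b)=(0,1)$ these are the Carlitz–Riordan $q$-Catalan numbers. *)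

(* Defs.v *)
From HB Require Import structures.
From mathcomp Require Import all_boot all_order all_algebra.
From mathcomp Require Import mpoly.

Set Implicit Arguments.
Unset Strict Implicit.
Unset Printing Implicit Defensive.

Import GRing.Theory.
Local Open Scope ring_scope.

Section QNarayana.

Variable R : comNzRingType.
Implicit Types (a b q : R) (n k : nat).

(* The list [:: C_0; ...; C_n]: the recurrence refers to all earlier values,
   so the whole list is accumulated; see qNarayanaS for the recurrence. *)
Fixpoint qNarayana_seq a b q n : seq R :=
  if n is m.+1 then
    let s := qNarayana_seq a b q m in
    rcons s (a * s`_m + b * \sum_(k < m.+1) q ^+ k * s`_k * s`_(m - k))
  else [:: 1].

Definition qNarayana a b q n : R := (qNarayana_seq a b q n)`_n.

Lemma size_qNarayana_seq a b q n : size (qNarayana_seq a b q n) = n.+1.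
Proof. by elim: n => //= n IHn; rewrite size_rcons IHn. Qed.

Lemma nth_qNarayana_seq a b q n k :
  (k <= n)%N -> (qNarayana_seq a b q n)`_k = qNarayana a b q k.
Proof.
elim: n => [|n IHn]; first by rewrite leqn0 => /eqP->.
rewrite leq_eqVlt => /predU1P[-> //|lt_kn].
by rewrite /= nth_rcons size_qNarayana_seq lt_kn IHn.
Qed.

Lemma qNarayana0 a b q : qNarayana a b q 0 = 1.
Proof. by []. Qed.

Lemma qNarayanaS a b q n :
  qNarayana a b q n.+1 =
    a * qNarayana a b q n
    + b * \sum_(k < n.+1) q ^+ k * qNarayana a b q k * qNarayana a b q (n - k).
Proof.
rewrite {1}/qNarayana /= nth_rcons size_qNarayana_seq ltnn eqxx.
congr (_ + _ * _); apply: eq_bigr => k _.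
by rewrite !nth_qNarayana_seq ?leq_subr // -ltnS.
Qed.

End QNarayana.

(* The indeterminates of Z[a, b, q]. *)
Definition Xa : {mpoly int[3]} := 'X_(@Ordinal 3 0 isT).
Definition Xb : {mpoly int[3]} := 'X_(@Ordinal 3 1 isT).
Definition Xq : {mpoly int[3]} := 'X_(@Ordinal 3 2 isT).

Definition qNarayana_poly (n : nat) : {mpoly int[3]} := qNarayana Xa Xb Xq n.

(* Main.v *)
Require Import Defs.
From HB Require Import structures.
From mathcomp Require Import all_boot all_order all_algebra.
From mathcomp Require Import mpoly ring zify.

Set Implicit Arguments.
Unset Strict Implicit.
Unset Printing Implicit Defensive.

Import GRing.Theory.
Local Open Scope ring_scope.

(** Let f = sum C_n z^n, F = f(qz), and let g be f with b replaced by qb.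
    If w = 1 + c z w g and p = w g, conjugating the Hankel matrix of g by the
    unitriangular Toeplitz matrix of w gives the Hankel matrix of p.  Applied to
    f = 1 + z f (a + b F), after eliminating the first row and column, this turns
    det (C_{i+j}) into b^n q^{n^2} det (C_{i+j+1}) with one row less.  Applied to
    f = 1 + z (a + b f) g, it turns det (C_{i+j+1}) into a power of a + b times
    det (C_{i+j}) at (a, qb).  The two reductions alternate, and the second
    functional equation, where w = (a + b f) / (a + b), follows from the first
    one by [conv_shift_param]. *)

(** * Power series as coefficient sequences under convolution *)

Section Convolution.

Variable R : comNzRingType.
Implicit Types (a b c q : R) (u v w f g : nat -> R) (n N : nat) (p : {poly R}).

Definition conv u v n : R := \sum_(k < n.+1) u (n - k)%N * v k.

Lemma eq_conv u v u' v' : u =1 u' -> v =1 v' -> conv u v =1 conv u' v'.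
Proof. by move=> eu ev n; apply: eq_bigr => k _; rewrite eu ev. Qed.

Lemma convDr u v w n :
  conv u (fun k => v k + w k) n = conv u v n + conv u w n.
Proof. by rewrite -big_split; apply: eq_bigr => k _; rewrite mulrDr. Qed.

Lemma conv0 u v : conv u v 0 = u 0%N * v 0%N.
Proof. by rewrite /conv big_ord1. Qed.

Lemma convC u v n : conv u v n = conv v u n.
Proof.
rewrite /conv (reindex_inj rev_ord_inj); apply: eq_bigr => k _ /=.
by rewrite subSS subKn 1?mulrC // -ltnS.
Qed.

Lemma convZl c u v n : conv (fun k => c * u k) v n = c * conv u v n.
Proof. by rewrite /conv mulr_sumr; apply: eq_bigr => k _; rewrite mulrA. Qed.

Lemma convZr c u v n : conv u (fun k => c * v k) n = c * conv u v n.
Proof. by rewrite convC convZl convC. Qed.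

Definition dilate q u k : R := q ^+ k * u k.

Lemma conv_dilate q u v n :
  conv (dilate q u) (dilate q v) n = q ^+ n * conv u v n.
Proof.
rewrite /conv mulr_sumr; apply: eq_bigr => k _.
by rewrite /dilate mulrACA -exprD subnK // -ltnS.
Qed.

Definition affine a b u k : R := a *+ (k == 0%N) + b * u k.

Lemma conv_affine a b u v n :
  conv u (affine a b v) n = a * u n + b * conv u v n.
Proof.
rewrite /conv; under eq_bigr do rewrite mulrDr.
rewrite big_split /= mulr_sumr; congr (_ + _).
  rewrite big_ord_recl /= subn0 mulrC big1 ?addr0 // => k _.
  by rewrite mulr0n mulr0.
by apply: eq_bigr => k _; rewrite mulrCA.
Qed.

Lemma dilate_affine q a b u : dilate q (affine a b u) =1 affine a b (dilate q u).
Proof.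
case=> [|i]; first by rewrite /dilate /affine !expr0 !mul1r.
by rewrite /dilate /affine !mulr0n !add0r mulrCA.
Qed.

(** Solves w = 1 + c z w u without dividing by anything; the list carries all earlier values, which
    the recursion needs. *)
Lemma conv_rec_exists u c :
  exists w, w 0%N = 1 /\ forall n, w n.+1 = c * conv w u n.
Proof.
pose s := fix s n := if n is m.+1 then
  rcons (s m) (c * \sum_(k < m.+1) (s m)`_(m - k) * u k) else [:: 1].
have size_s n : size (s n) = n.+1.
  by elim: n => //= n IHn; rewrite size_rcons IHn.
have nth_s n k : (k <= n)%N -> (s n)`_k = (s k)`_k.
  elim: n => [|n IHn]; first by rewrite leqn0 => /eqP->.
  rewrite leq_eqVlt => /predU1P[-> //|lt_kn].
  by rewrite /= nth_rcons size_s lt_kn IHn.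
exists (fun n => (s n)`_n); split=> // n.
rewrite /= nth_rcons size_s ltnn eqxx; congr (_ * _); apply: eq_bigr => k _.
by rewrite nth_s // leq_subr.
Qed.

(** Truncations turn identities between series into polynomial identities modulo ['X^N], where
    [ring] applies. *)
Definition trunc N u : {poly R} := \poly_(i < N) u i.

Lemma coef_trunc N u n : (n < N)%N -> (trunc N u)`_n = u n.
Proof. by move=> lt_nN; rewrite coef_poly lt_nN. Qed.

Lemma eq_trunc N u v : u =1 v -> trunc N u = trunc N v.
Proof. by move=> euv; apply/polyP=> i; rewrite !coef_poly euv. Qed.

Lemma truncZ N c u : trunc N (fun k => c * u k) = c%:P * trunc N u.
Proof.
by apply/polyP=> i; rewrite coefCM !coef_poly; case: ifP; rewrite ?mulr0.
Qed.

Lemma coef_truncM N u v n :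
  (n < N)%N -> (trunc N u * trunc N v)`_n = conv u v n.
Proof.
move=> lt_nN; rewrite convC coefM; apply: eq_bigr => k _.
by rewrite mulrC !coef_trunc //; have := ltn_ord k; lia.
Qed.

Lemma trunc_affine N a b u :
  trunc N.+1 (affine a b u) = a%:P + b%:P * trunc N.+1 u.
Proof.
apply/polyP=> i; rewrite coefD coefC coefCM !coef_poly /affine.
by case: ltnP => [_|]; case: i => //= *; rewrite mulr0 addr0.
Qed.

Lemma poly_modXn N p :
  (forall n, (n < N)%N -> p`_n = 0) -> exists r, p = r * 'X^N.
Proof.
move=> p0; exists (drop_poly N p); rewrite -{1}(poly_take_drop N p).
suff ->: take_poly N p = 0 by rewrite add0r.
by apply/polyP=> i; rewrite coef_take_poly coef0; case: ifP => // /p0.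
Qed.

Lemma trunc_conv_rec N u v : u 0%N = 1 -> (forall n, u n.+1 = conv u v n) ->
  exists r, trunc N u = 1 + 'X * (trunc N u * trunc N v) + r * 'X^N.
Proof.
move=> u0 uS.
have [n lt_nN|r Dr] := @poly_modXn N
    (trunc N u - (1 + 'X * (trunc N u * trunc N v))).
  rewrite coefB coefD coef1 coefXM coef_trunc //.
  case: n lt_nN => [|n] lt_nN /=; first by rewrite u0 addr0 subrr.
  by rewrite coef_truncM 1?ltnW // uS add0r subrr.
by exists r; rewrite -Dr addrC subrK.
Qed.

(* With F = f(qz), G = g(qz), the difference e = f (a + b F) - (a + b f) g
   satisfies e = q b z f g e(qz), hence vanishes. *)
Lemma conv_shift_param a b q f g :
    f 0%N = 1 -> (forall n, f n.+1 = conv f (affine a b (dilate q f)) n) ->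
    g 0%N = 1 -> (forall n, g n.+1 = conv g (affine a (q * b) (dilate q g)) n) ->
  forall n, f n.+1 = conv (affine a b f) g n.
Proof.
move=> f0 fS g0 gS n.
set V := affine a b (dilate q f); set v := affine a b f.
suff: conv f V n - conv v g n = 0 by rewrite fS => /subr0_eq.
(* The precision stays fixed while [n] varies in the induction below. *)
have [N ltnN] : exists N, (n < N.+1)%N by exists n.
have [r Df] := @trunc_conv_rec N.+1 f V f0 fS.
have [s Dg] := @trunc_conv_rec N.+1 g _ g0 gS.
(* Substituting qz for z in f = 1 + z f V gives F = 1 + z F (q V(qz)). *)
have [||t DF] :=
  @trunc_conv_rec N.+1 (dilate q f) (fun k => q * dilate q V k).
- by rewrite /dilate mul1r.
- by move=> m; rewrite convZr conv_dilate mulrA -exprS -fS.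
have DV : trunc N.+1 V = a%:P + b%:P * trunc N.+1 (dilate q f).
  exact: trunc_affine.
have Dv : trunc N.+1 v = a%:P + b%:P * trunc N.+1 f by exact: trunc_affine.
have DV2 : trunc N.+1 (dilate q V)
    = a%:P + b%:P * trunc N.+1 (dilate q (dilate q f)).
  by rewrite (eq_trunc _ (dilate_affine _ _ _ _)) trunc_affine.
set e := fun n => conv f V n - conv v g n.
set E := trunc N.+1 f * trunc N.+1 V - trunc N.+1 v * trunc N.+1 g.
set E' := trunc N.+1 (dilate q f) * trunc N.+1 (dilate q V)
          - trunc N.+1 (dilate q v) * trunc N.+1 (dilate q g).
have DE m : (m < N.+1)%N -> E`_m = e m.
  by move=> ltmN; rewrite coefB !coef_truncM.
have DE' m : (m < N.+1)%N -> E'`_m = q ^+ m * e m.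
  by move=> ltmN; rewrite coefB !coef_truncM // !conv_dilate -mulrBr.
have Dv' : trunc N.+1 (dilate q v) = trunc N.+1 V.
  exact/eq_trunc/dilate_affine.
have [T EE'] : exists T,
    E = 'X * (T * E') + (b%:P * trunc N.+1 f * trunc N.+1 g * t
       - s * trunc N.+1 f * trunc N.+1 V + a%:P * trunc N.+1 g * r) * 'X^(N.+1).
  exists (q%:P * b%:P * trunc N.+1 f * trunc N.+1 g).
  rewrite /E /E' Dv' DV2 Dv DV.
  rewrite DV in Df; rewrite truncZ DV2 in DF; rewrite trunc_affine polyCM in Dg.
  move: (trunc _ f) (trunc _ g) (trunc _ (dilate q f)) (trunc _ (dilate q g))
    (trunc _ (dilate q (dilate q f))) Df Dg DF => pf pg pF pG pF2 Df Dg DF.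
  apply/subr0_eq.
  move/eqP: Df; rewrite -subr_eq0; set zf := _ - _ => /eqP Df.
  move/eqP: Dg; rewrite -subr_eq0; set zg := _ - _ => /eqP Dg.
  move/eqP: DF; rewrite -subr_eq0; set zF := _ - _ => /eqP DF.
  (* With these cofactors the leading terms a f g + b f g F - f g V cancel, the constants 1
     contribute E, and the terms in ['X] contribute - z q b f g E'. *)
  transitivity (a%:P * pg * zf + b%:P * pf * pg * zF
                - pf * (a%:P + b%:P * pF) * zg); last first.
    by rewrite Df Dg DF !mulr0 subr0 addr0.
  by rewrite /zf /zg /zF; ring.
(* The factor ['X] makes [e n] depend only on the [e m] with m < n. *)
rewrite -/(e n); elim/ltn_ind: n ltnN => n IHn ltnN.
rewrite -DE // EE' coefD coefMXn ltnN addr0 coefXM.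
case: n IHn ltnN => //= n IHn ltnN.
rewrite coefM big1 // => k _.
by rewrite DE' ?IHn ?mulr0 //; lia.
Qed.

End Convolution.

(** * Hankel determinants under Toeplitz congruence, elimination and scaling *)

Section HankelDeterminants.

Variable R : comNzRingType.
Implicit Types (a b c q : R) (u w g : nat -> R) (i j n : nat).

Definition hankel u n : 'M[R]_n := \matrix_(i < n, j < n) u (i + j)%N.

Definition toeplitz u n : 'M[R]_n :=
  \matrix_(i < n, j < n) if (j <= i)%N then u (i - j)%N else 0.

Lemma det_toeplitz u n : \det (toeplitz u n) = u 0%N ^+ n.
Proof.
rewrite det_trig.
  under eq_bigr do rewrite mxE leqnn subnn.
  by rewrite prodr_const card_ord.
apply/is_trig_mxP => i j lt_ij; rewrite mxE leqNgt.
by case: leqP => //; lia.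
Qed.

Lemma mul_toeplitz_hankel u g n (i j : 'I_n) :
  (toeplitz u n *m hankel g n) i j = conv u (fun k => g (k + j)%N) i.
Proof.
rewrite mxE /conv (bigID (fun k : 'I_n => (k < i.+1)%N)) /=.
rewrite [X in _ + X]big1 ?addr0; last first.
  by move=> k; rewrite -leqNgt !mxE => lt_ik; rewrite leqNgt lt_ik mul0r.
rewrite [RHS](big_ord_widen_cond n predT
  (fun k => u (i - k)%N * g (k + j)%N)) //.
by apply: eq_bigr => k; rewrite !mxE ltnS => ->.
Qed.

Lemma toeplitz_hankelE u g n (i j : 'I_n) :
  (toeplitz u n *m hankel g n *m (toeplitz u n)^T) i j =
  conv u (fun l => conv u (fun k => g (k + l)%N) i) j.
Proof.
rewrite mxE /conv (bigID (fun k : 'I_n => (k < j.+1)%N)) /=.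
rewrite [X in _ + X]big1 ?addr0; last first.
  move=> k; rewrite -leqNgt [_^T _ _]mxE [toeplitz _ _ _ _]mxE => lt_jk.
  by rewrite leqNgt lt_jk mulr0.
rewrite [RHS](big_ord_widen_cond n predT
  (fun l => u (j - l)%N * conv u (fun k => g (k + l)%N) i)) //.
apply: eq_bigr => k; rewrite mul_toeplitz_hankel [_^T _ _]mxE.
by rewrite [toeplitz _ _ _ _]mxE ltnS => ->; rewrite mulrC.
Qed.

Lemma conv_shift_arg u g n :
  conv u (fun k => g k.+1) n = conv u g n.+1 - u n.+1 * g 0%N.
Proof.
rewrite /conv [X in _ = X - _]big_ord_recl subn0 addrAC subrr add0r.
by apply: eq_bigr => k _; rewrite lift0 subSS.
Qed.

Section ConvRec.

Variables (c : R) (w g : nat -> R).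
Hypothesis wS : forall n, w n.+1 = c * conv w g n.

(** The coefficient of x^i y^j in w(x) w(y) (x g(x) - y g(y)) / (x - y). *)
Let biconv i j := conv w (fun l => conv w (fun k => g (k + l)%N) i) j.

Lemma biconv_shift i j :
  conv w (fun l => conv w (fun k => g (k + l).+1) i) j =
  biconv i j.+1 - c * conv w g i * conv w g j.
Proof.
rewrite (@eq_conv _ w _ w (fun l => conv w (fun k => g (k + l.+1)%N) i)) //.
  rewrite (conv_shift_arg w (fun l => conv w (fun k => g (k + l)%N) i)) wS.
  rewrite -mulrA [conv w g j * _]mulrC mulrA; congr (_ - _ * _ * _).
  by apply: eq_conv => // k; rewrite addn0.
by move=> l; apply: eq_conv => // k; rewrite addnS.
Qed.

(** The correction term in [biconv_shift] is symmetric in i and j, so raising either index has the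
    same effect: the array is Hankel, hence determined by its row 0. *)
Lemma biconvSl i j : biconv i.+1 j = biconv i j.+1.
Proof.
have E l : conv w (fun k => g (k + l)%N) i.+1
    = w i.+1 * g l + conv w (fun k => g (k + l).+1) i.
  by rewrite (conv_shift_arg w (fun k => g (k + l)%N)) add0n addrC subrK.
rewrite /biconv (eq_conv (frefl w) E) convDr convZr biconv_shift wS.
by rewrite addrC subrK.
Qed.

Lemma biconvE i j : biconv i j = w 0%N * conv w g (i + j).
Proof.
elim: i j => [|i IHi] j; last by rewrite biconvSl IHi addnS.
rewrite -convZr; apply: eq_conv => // l.
by rewrite conv0 add0n.
Qed.

Lemma det_hankel_conv n :
  w 0%N = 1 -> \det (hankel (conv w g) n) = \det (hankel g n).
Proof.
move=> w0.
have -> : hankel (conv w g) n = toeplitz w n *m hankel g n *m (toeplitz w n)^T.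
  by apply/matrixP => i j; rewrite toeplitz_hankelE -/(biconv i j) biconvE w0
                                   mul1r mxE.
by rewrite !det_mulmx det_tr det_toeplitz w0 expr1n mul1r mulr1.
Qed.

End ConvRec.

(** Schur complement of the corner entry 1, by a block LU factorisation. *)
Lemma det_hankelS u n : u 0%N = 1 ->
  \det (hankel u n.+1) =
  \det (\matrix_(i < n, j < n) (u (i + j).+2 - u i.+1 * u j.+1)).
Proof.
move=> u0; set N := \matrix_(i, j) _.
pose r : 'rV[R]_n := \row_j u j.+1.
have -> : hankel u n.+1 = block_mx 1 0 r^T 1%:M *m block_mx 1 r 0 N
    :> 'M_(1 + n).
  rewrite mulmx_block !mul1mx !mul0mx !addr0 mulmx1.
  apply/matrixP => i j; rewrite mxE.
  case: (split_ordP i) => i' ->; case: (split_ordP j) => j' ->.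
  - by rewrite block_mxEul !ord1 mxE.
  - by rewrite block_mxEur !ord1 mxE.
  - by rewrite block_mxEdl !ord1 !mxE addn0.
  - rewrite block_mxEdr !mxE big_ord1 !mxE /= addrC subrK.
    by rewrite !add1n addSn addnS.
by rewrite det_mulmx (@det_lblock _ 1 n) (@det_ublock _ 1 n) !det1 !mul1r.
Qed.

(** For c = 1 the correction in [biconv_shift] is exactly the rank-one term that elimination
    subtracts, so the Schur complement is congruent to the Hankel matrix of the shifted g. *)
Lemma det_hankelS_conv u g n :
    u 0%N = 1 -> (forall n, u n.+1 = conv u g n) ->
  \det (hankel u n.+1) = \det (hankel (fun k => g k.+1) n).
Proof.
move=> u0 uS; rewrite det_hankelS //.
set N := \matrix_(i, j) _.
have uS1 k : u k.+1 = 1 * conv u g k by rewrite mul1r.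
have -> : N =
    toeplitz u n *m hankel (fun k => g k.+1) n *m (toeplitz u n)^T.
  apply/matrixP => i j; rewrite toeplitz_hankelE mxE.
  by rewrite (biconv_shift uS1) (biconvE uS1) u0 !mul1r addnS -!uS.
by rewrite !det_mulmx det_tr det_toeplitz u0 expr1n mul1r mulr1.
Qed.

Lemma det_hankelZ c u n :
  \det (hankel (fun k => c * u k) n) = c ^+ n * \det (hankel u n).
Proof. by rewrite -detZ; congr (\det _); apply/matrixP=> i j; rewrite !mxE. Qed.

Lemma det_hankel_dilate q u n :
  \det (hankel (dilate q u) n) = q ^+ (n * n.-1) * \det (hankel u n).
Proof.
pose d : 'rV[R]_n := \row_j q ^+ j.
have -> : hankel (dilate q u) n = diag_mx d *m hankel u n *m diag_mx d.
  apply/matrixP => i j; rewrite mul_mx_diag mul_diag_mx !mxE.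
  by rewrite /dilate exprD mulrAC.
have det_d : \det (diag_mx d) = q ^+ 'C(n, 2).
  rewrite det_diag; under eq_bigr do rewrite mxE.
  by rewrite prodrXr -bin2_sum big_mkord.
rewrite !det_mulmx mulrAC det_d -exprD; congr (q ^+ _ * _).
(* Rows and columns each contribute 'C(n, 2), and n (n - 1) is even. *)
rewrite addnn bin2 even_halfK // oddM.
by case: (n) => //= m; rewrite andNb.
Qed.

End HankelDeterminants.

(** * The two reductions for q-Narayana polynomials and their iteration *)

Section QNarayanaHankel.

Variable R : comNzRingType.
Implicit Types (a b q : R) (n : nat).

Local Notation C := qNarayana.

Lemma qNarayana_conv a b q n :
  C a b q n.+1 = conv (C a b q) (affine a b (dilate q (C a b q))) n.
Proof.
rewrite qNarayanaS conv_affine; congr (_ + _ * _); apply: eq_bigr => k _.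
by rewrite /dilate mulrC.
Qed.

Lemma det_qNarayanaS a b q n :
  \det (hankel (C a b q) n.+1) =
  b ^+ n * q ^+ (n ^ 2) * \det (hankel (fun k => C a b q k.+1) n).
Proof.
rewrite (det_hankelS_conv _ (qNarayana0 a b q) (qNarayana_conv a b q)).
(* The shift discards the constant a; what is left yields (b q)^n by scaling and q^(n (n - 1)) by
   dilation. *)
have E : (fun k => affine a b (dilate q (C a b q)) k.+1) =1
  (fun k => (b * q) * dilate q (fun k => C a b q k.+1) k).
  by move=> k; rewrite /affine /dilate mulr0n add0r exprS !mulrA.
have -> : hankel (fun k => affine a b (dilate q (C a b q)) k.+1) n = 
          hankel (fun k => (b * q) * dilate q (fun k => C a b q k.+1) k) n.
  by apply/matrixP => i j; rewrite !mxE E.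
rewrite det_hankelZ det_hankel_dilate mulrA exprMn -[_ * q ^+ (_ * _)]mulrA.
by rewrite -exprD; congr (_ * q ^+ _ * _); case: n => //= n; rewrite -mulnS mulnn.
Qed.

Lemma det_qNarayana_shift a b q n :
  \det (hankel (fun k => C a b q k.+1) n) =
  (a + b) ^+ n * \det (hankel (C a (q * b) q) n).
Proof.
(* As a + b need not be invertible in [R], w is built from its recurrence, and a + b f = (a + b) w
   is then proved by induction. *)
have [w [w0 wS]] := conv_rec_exists (C a (q * b) q) b.
have fS := conv_shift_param (qNarayana0 a b q) (qNarayana_conv a b q)
  (qNarayana0 a (q * b) q) (qNarayana_conv a (q * b) q).
have fE k : affine a b (C a b q) k = (a + b) * w k.
  elim/ltn_ind: k => -[|k] IHk; first by rewrite /affine w0 qNarayana0 !mulr1.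
  rewrite /affine mulr0n add0r wS fS mulrCA; congr (_ * _); rewrite -convZl.
  by apply: eq_bigr => l _; rewrite IHk // ltnS leq_subr.
rewrite -(det_hankel_conv wS n w0) -det_hankelZ; congr (\det _).
by apply/matrixP => i j; rewrite !mxE fS -convZl; apply: eq_conv.
Qed.

(** Induction with b general: one round of both reductions replaces b by q b, which moves the factor
    a + q^k b to index k + 1. *)
Lemma det_qNarayana_shiftE a b q n :
  \det (hankel (fun k => C a b q k.+1) n) =
  q ^+ ('C(n, 2) * n) * b ^+ 'C(n, 2)
    * \prod_(0 <= k < n) (a + q ^+ k * b) ^+ (n - k).
Proof.
elim: n b => [|n IHn] b; first by rewrite det_mx00 big_geq // !mulr1.
rewrite det_qNarayana_shift det_qNarayanaS IHn big_nat_recl // expr0 mul1r subn0.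
under [in RHS]eq_bigr do rewrite exprSr -mulrA subSS.
set P := \prod_(_ <= _ < _) _; set s := (a + b) ^+ _.
rewrite binS bin1 !exprMn.
(* Powers of q: n and 'C(n, 2) come from the powers of q b, n^2 from the elimination, the rest from
   the induction hypothesis. *)
have -> : (('C(n, 2) + n) * n.+1 = n + n ^ 2 + 'C(n, 2) * n + 'C(n, 2))%N by lia.
by rewrite !exprD; ring.
Qed.

Lemma det_qNarayanaE a b q n :
  \det (hankel (C a b q) n.+1) =
  q ^+ ('C(n.+1, 2) * n) * b ^+ 'C(n.+1, 2)
    * \prod_(0 <= k < n) (a + q ^+ k * b) ^+ (n - k).
Proof.
rewrite det_qNarayanaS det_qNarayana_shiftE.
set P := \prod_(_ <= _ < _) _; rewrite binS bin1.
have -> : (('C(n, 2) + n) * n = n ^ 2 + 'C(n, 2) * n)%N by lia.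
by rewrite !exprD; ring.
Qed.

End QNarayanaHankel.

Lemma bin2_double n : ('C(n.+1, 2) * 2 = n * n.+1)%N.
Proof.
rewrite bin2 muln2 even_halfK; first by rewrite mulnC.
by rewrite oddM /= andNb.
Qed.

Theorem mainTheorem1 (n : nat) :
  \det (\matrix_(i < n.+1, j < n.+1) qNarayana_poly (i + j))
    = Xq ^+ ((n ^ 2 * (n + 1)) %/ 2) * Xb ^+ 'C(n + 1, 2)
      * \prod_(0 <= k < n) (Xa + Xq ^+ k * Xb) ^+ (n - k)
  /\
  \det (\matrix_(i < n.+1, j < n.+1) qNarayana_poly (i + j + 1))
    = Xq ^+ ((n * (n + 1) ^ 2) %/ 2) * Xb ^+ 'C(n + 1, 2)
      * \prod_(0 <= k < n.+1) (Xa + Xq ^+ k * Xb) ^+ (n + 1 - k).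
Proof.
have bn := bin2_double n; rewrite addn1; split.
  (* The division by 2 in the exponent is exact. *)
  have -> : (n ^ 2 * n.+1 = ('C(n.+1, 2) * n) * 2)%N by nia.
  by rewrite mulnK // -det_qNarayanaE.
have -> : (n * n.+1 ^ 2 = ('C(n.+1, 2) * n.+1) * 2)%N by nia.
rewrite mulnK // -det_qNarayana_shiftE; congr (\det _).
by apply/matrixP => i j; rewrite !mxE addn1.
Qed.
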